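(* Let $G=(X,E)$ be a finite connected graph, $x\neq y\in X$, and $W:X\to\mathbb{R}$ a function whose global maximum is attained exactly at $x$ and $y$. Assume there is an involutive automorphism $\sigma$ of $G$ with $\sigma(x)=y$ and $W\circ\sigma=W$. Then, for $H=\Delta-QW$, there is perfect asymptotic tunneling between $x$ and $y$ ($TC(x,y)=TC(y,x)=1$), and the tunneling time is of order $Q^{d(x,y)-1}$.
   Context: $d_v$ is the degree of $v$, $d(\cdot,\cdot)$ the graph distance. The symmetrized Laplacian $\Delta$ has $\Delta(v,v)=1$, $\Delta(v,w)=-1/\sqrt{d_vd_w}$ if $vw\in E$, $0$ otherwise; $H=\Delta-QW$ with $W$ as a diagonal matrix and $Q$ a real parameter. Starting from vertex $u$, the state is $\varphi_t=e^{itH}\chi_u$ ($\chi_u$ the indicator of $u$), depending on $Q$. $TC(u,v)=\liminf_{Q\to\infty}\sup_{t\in[0,\infty)}|\varphi_t(v)|^2$; perfect tunneling means $TC=1$. Tunneling from $u$ to $v$ happens within time $f(Q)$ if $TC(u,v)=\liminf_{Q\to\infty}\sup_{t\in[0,f(Q)]}|\varphi_t(v)|^2$; ''tunneling time of order $g(Q)$'' means tunneling happens within some time $f(Q)=O(g(Q))$ but not within any time $f(Q)=o(g(Q))$. *)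

(* Defs.v *)
From HB Require Import structures.
From mathcomp Require Import all_boot all_order all_algebra.
From mathcomp Require Import all_classical all_reals all_analysis.
From mathcomp Require Import complex.
Set Implicit Arguments. Unset Strict Implicit. Unset Printing Implicit Defensive.
Import Order.TTheory GRing.Theory Num.Theory.
Import numFieldNormedType.Exports.
Local Open Scope classical_set_scope.
Local Open Scope ring_scope.

Section QuantumTunneling.
Variables (R : realType) (n : nat).

Definition simple_graph (e : rel 'I_n) : Prop := symmetric e /\ irreflexive e.
Definition connected_graph (e : rel 'I_n) : Prop := forall a b, connect e a b.

(* graph distance: least length of a walk from x to y (walks of length < n suffice
   in a connected graph). *)
Definition gdist (e : rel 'I_n) (x y : 'I_n) : nat :=
  find (fun k => [exists p : k.-tuple 'I_n, path e x p && (last x p == y)])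
       (iota 0 n).

Definition graph_aut (e : rel 'I_n) (s : 'I_n -> 'I_n) : Prop :=
  bijective s /\ forall a b, e (s a) (s b) = e a b.

Definition degree (e : rel 'I_n) (v : 'I_n) : R := #|[set w | e v w]|%:R.

Definition sym_laplacian (e : rel 'I_n) : 'M[R]_n :=
  \matrix_(v, w) (if v == w then 1
                  else if e v w then - (Num.sqrt (degree e v * degree e w))^-1
                  else 0).

Definition hamiltonian (e : rel 'I_n) (W : 'I_n -> R) (Q : R) : 'M[R]_n :=
  sym_laplacian e - Q *: diag_mx (\row_v W v).

Local Open Scope complex_scope.
(* N-th partial sum of the exponential series of (e^{itH} chi_u)(v) = (e^{itH})_{v,u} *)
Definition evol_partial (H : 'M[R]_n) (t : R) (u v : 'I_n) (N : nat) : R[i] :=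
  \sum_(k < N) ((t *i) ^+ k / (k`!)%:R) * ((map_mx (real_complex R) H) ^+ k) v u.
Local Close Scope complex_scope.

(* |phi_t(v)|^2 where phi_t = e^{itH} chi_u *)
Definition amp2 (H : 'M[R]_n) (t : R) (u v : 'I_n) : R :=
  (limn (fun N => complex.Re (evol_partial H t u v N))) ^+ 2
  + (limn (fun N => complex.Im (evol_partial H t u v N))) ^+ 2.

Definition liminf_sup (e : rel 'I_n) (W : 'I_n -> R) (u v : 'I_n)
    (T : R -> set R) : \bar R :=
  limf_einf (fun Q => ereal_sup [set (amp2 (hamiltonian e W Q) t u v)%:E | t in T Q])
            (pinfty_nbhs R).

Definition TC (e : rel 'I_n) (W : 'I_n -> R) (u v : 'I_n) : \bar R :=
  liminf_sup e W u v (fun _ => [set t | 0 <= t]).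

Definition tunnels_within (e : rel 'I_n) (W : 'I_n -> R) (u v : 'I_n)
    (f : R -> R) : Prop :=
  TC e W u v = liminf_sup e W u v (fun Q => [set t | 0 <= t <= f Q]).

Definition bigO_oo (f g : R -> R) : Prop :=
  exists C : R, \forall Q \near pinfty_nbhs R, `|f Q| <= C * `|g Q|.
Definition littleo_oo (f g : R -> R) : Prop :=
  forall eps : R, 0 < eps -> \forall Q \near pinfty_nbhs R, `|f Q| <= eps * `|g Q|.

Definition tunneling_time_of_order (e : rel 'I_n) (W : 'I_n -> R) (u v : 'I_n)
    (g : R -> R) : Prop :=
  (exists f, bigO_oo f g /\ tunnels_within e W u v f) /\
  (forall f, littleo_oo f g -> ~ tunnels_within e W u v f).

End QuantumTunneling.

(* Main.v *)
(** Up to an energy shift, [H = Q w - A] with [A] the normalised adjacency matrix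
    and [w = W x - W >= 0], which vanishes only at [x] and [y].  For each sign,
    [chi_x ± chi_y] is moved by [H] by a bounded amount, so [H] has an eigenvector
    [p±] with bounded eigenvalue that is not orthogonal to it; symmetrising with
    [sigma] and scaling gives [p±(x) = 1], [p±(y) = ±1], and the eigenvalue equation
    makes the rest of [p±] of size [O(1/Q)].  Hence [chi_x = (p+ + p-)/2 + O(1/Q)] and
    [phi_t(y) = (e^{itE+} - e^{itE-})/2 + O(1/Q)] uniformly in [t].

    The half difference [be = (p+ - p-)/2] satisfies [be(x) = 0], [be(y) = 1], and each
    step away from [y] costs exactly one factor [1/Q]: [be(r)] is of exact order
    [Q^-d(r,y)], all leading contributions being positive.  The equation at [x] turns
    this into [|E+ - E-|] of exact order [Q^-(d(x,y)-1)]. *)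

Require Import Defs.
From HB Require Import structures.
From mathcomp Require Import all_boot all_order all_algebra.
From mathcomp Require Import all_classical all_reals all_analysis.
From mathcomp Require Import complex.
From mathcomp Require Import ring lra.
Import Order.TTheory GRing.Theory Num.Theory.
Local Open Scope ring_scope.
Set Implicit Arguments. Unset Strict Implicit. Unset Printing Implicit Defensive.
Import numFieldNormedType.Exports.

(** * Real spectral decomposition of a symmetric matrix *)

Section EigenFrame.
Variables (R : realType) (n : nat).
Local Notation toC := (real_complex R).

(* The real and imaginary parts of a unitary eigenbasis: a real Parseval frame of
   [2n] eigenvectors, as good as an orthonormal eigenbasis for all that follows. *)
Lemma symmetric_eigenframe (M : 'M[R]_n) : M^T = M ->
  exists (l : 'I_n + 'I_n -> R) (a : 'I_n + 'I_n -> 'I_n -> R),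
    (forall i v, \sum_u M v u * a i u = l i * a i v) /\
    (forall u v, \sum_i a i u * a i v = (u == v)%:R).
Proof.
move=> Msym; set A := map_mx toC M.
have Asym : A \is symmetricmx.
  apply/is_hermitianmxP; rewrite expr0 scale1r map_mx_id //.
  by apply/matrixP => i j; rewrite !mxE -{1}Msym mxE.
have Areal : A \is a realmx.
  by apply/mxOverP => i j; rewrite mxE; apply/complex_realP; exists (M i j).
have Aherm := realsym_hermsym Asym Areal.
have /orthomx_spectralP Aeq := hermitian_normalmx Aherm.
have /mxOverP Dreal := hermitian_spectral_diag_real Aherm.
set P := spectralmx A in Aeq *; set D := spectral_diag A in Aeq Dreal *.
have Pu : P \in unitmx := spectral_unit A.
have PA : P *m A = diag_mx D *m P by rewrite {1}Aeq !mulmxA mulmxV ?mul1mx.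
have PtP : (invmx P) *m P = 1%:M by rewrite mulVmx.
rewrite invmx_unitary ?spectral_unitarymx // in PtP.
pose lam j := complex.Re (D 0 j).
pose a (s : 'I_n + 'I_n) v := match s with inl j => complex.Re (P j v)
                                         | inr j => complex.Im (P j v) end.
exists (fun s => match s with inl j => lam j | inr j => lam j end), a.
(* As [M] is symmetric, the rows of [P] are right eigenvectors; the eigenvalues being real, real and
   imaginary parts are then eigenvectors separately. *)
have key j v : \sum_u (P j u * toC (M v u)) = toC (lam j) * P j v.
  have := congr1 (fun B : 'M[R[i]]_n => B j v) PA; rewrite mul_diag_mx !mxE.
  rewrite (RRe_real (Dreal 0 j)) => <-; apply: eq_bigr => u _.
  by rewrite mxE -{1}Msym mxE.
split.
- have ReM (z : R[i]) (c : R) : complex.Re (z * toC c) = c * complex.Re z.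
    by case: z => r i /=; rewrite mulr0 subr0 mulrC.
  have ImM (z : R[i]) (c : R) : complex.Im (z * toC c) = c * complex.Im z.
    by case: z => r i /=; rewrite mulr0 add0r mulrC.
  case=> j v /=.
    rewrite -ReM mulrC -key (raddf_sum (@complex.Re R : Rcomplex R -> R)).
    by apply: eq_bigr => u _; exact/esym/ReM.
  rewrite -ImM mulrC -key (raddf_sum (@complex.Im R : Rcomplex R -> R)).
  by apply: eq_bigr => u _; exact/esym/ImM.
(* The frame identity is the real part of [P^* P = 1]. *)
- move=> u v; have := congr1 (fun B : 'M[R[i]]_n => complex.Re (B u v)) PtP.
  rewrite !mxE (raddf_sum (@complex.Re R : Rcomplex R -> R)) /= big_sumType /=.
  rewrite -big_split /=.
  have -> : complex.Re ((u == v)%:R : R[i]) = (u == v)%:R by case: (u == v).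
  move=> <-; apply: eq_bigr => j _; rewrite !mxE.
  have -> : Num.conj (P j u) = conjc (P j u) by [].
  by case: (P j u) (P j v) => [r i] [r' i'] /=; ring.
Qed.
End EigenFrame.

(** * Quantum evolution expressed in an eigenframe *)

Section Evolution.
Variables (R : realType) (n : nat) (M : 'M[R]_n).
Variables (I : finType) (l : I -> R) (a : I -> 'I_n -> R).
Hypothesis eig : forall i v, \sum_u M v u * a i u = l i * a i v.
Hypothesis frame : forall u v, \sum_i a i u * a i v = (u == v)%:R.
Local Notation toC := (real_complex R).

Lemma frame_expmx k u v : (M ^+ k) v u = \sum_i l i ^+ k * (a i v * a i u).
Proof.
elim: k u v => [|k IH] u v.
  by rewrite expr0 -[1]/(1%:M) mxE -frame; apply: eq_bigr => i _; rewrite mul1r.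
rewrite exprS -[_ * _]/(M *m (M ^+ k)) mxE.
under eq_bigr => w _ do rewrite IH mulr_sumr.
rewrite exchange_big /=; apply: eq_bigr => i _.
transitivity (l i ^+ k * a i u * \sum_w M v w * a i w).
  by rewrite mulr_sumr; apply: eq_bigr => w _; ring.
by rewrite eig exprS; ring.
Qed.

Lemma exp_i_coeff (s : R) k :
  (Complex 0 1 : R[i]) ^+ k * toC (s ^+ k / k`!%:R) = Complex (cos_coeff s k) (sin_coeff s k).
Proof.
(* Powers of i by parity, in the shape of [cos_coeff] and [sin_coeff]. At [k = 0] the truncated
   predecessor is harmless, since [odd 0] kills its factor. *)
have -> : (Complex 0 1 : R[i]) ^+ k =
   Complex ((~~ odd k)%:R * (-1) ^+ k./2) ((odd k)%:R * (-1) ^+ k.-1./2).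
  elim: k => [|k IH]; first by rewrite expr0 /= mul1r mul0r.
  rewrite exprS IH /=; case: k {IH} => [|k] /=.
    by apply/eqP; rewrite eq_complex /=; apply/andP; split; apply/eqP; ring.
  rewrite negbK; case: (odd k) => /=; apply/eqP; rewrite eq_complex /=;
    by apply/andP; split; apply/eqP; rewrite ?exprS; ring.
rewrite /cos_coeff /sin_coeff /=; apply/eqP; rewrite eq_complex /=.
by rewrite -?exprnP; apply/andP; split; apply/eqP; ring.
Qed.

(** Diagonalising in the frame splits the matrix exponential into scalar series, one for each frame
    vector, with limits the cosine and sine of [t * l i]. *)
Lemma evol_partialE t u v N : evol_partial M t u v N =
  Complex (\sum_i a i v * a i u * series (cos_coeff (t * l i)) N)
          (\sum_i a i v * a i u * series (sin_coeff (t * l i)) N).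
Proof.
transitivity (\sum_(k < N) \sum_i toC (a i v * a i u) *
   (Complex (cos_coeff (t * l i) k) (sin_coeff (t * l i) k) : R[i])).
  rewrite /evol_partial; apply: eq_bigr => k _.
  have -> : (map_mx toC M) ^+ k = map_mx toC (M ^+ k).
    elim: (nat_of_ord k) => [|j IH].
      by rewrite !expr0 -[1]/(1%:M) -[RHS]/(map_mx toC 1%:M) map_mx1.
    by rewrite !exprS IH -[LHS]/(_ *m _) -[in RHS]/(M *m _) map_mxM.
  rewrite mxE frame_expmx rmorph_sum mulr_sumr; apply: eq_bigr => i _.
  rewrite -exp_i_coeff.
  have -> : (Complex 0 t : R[i]) = Complex 0 1 * toC t.
    by apply/eqP; rewrite eq_complex /=; apply/andP; split; apply/eqP; ring.
  rewrite !(rmorphM, rmorphXn, fmorphV, rmorph_nat) /= !exprMn; ring.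
rewrite exchange_big /=.
apply/eqP; rewrite eq_complex; apply/andP; split; apply/eqP.
  rewrite (raddf_sum (@complex.Re R : Rcomplex R -> R)) /=.
  apply: eq_bigr => i _; rewrite (raddf_sum (@complex.Re R : Rcomplex R -> R)) /=.
  by rewrite seriesEord mulr_sumr; apply: eq_bigr => k _ /=; ring.
rewrite (raddf_sum (@complex.Im R : Rcomplex R -> R)) /=.
apply: eq_bigr => i _; rewrite (raddf_sum (@complex.Im R : Rcomplex R -> R)) /=.
by rewrite seriesEord mulr_sumr; apply: eq_bigr => k _ /=; ring.
Qed.

Definition evol_cos t v u : R := \sum_i a i v * a i u * cos (t * l i).
Definition evol_sin t v u : R := \sum_i a i v * a i u * sin (t * l i).

Lemma amp2E t u v : amp2 M t u v = evol_cos t v u ^+ 2 + evol_sin t v u ^+ 2.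
Proof.
rewrite /amp2; congr (_ ^+ 2 + _ ^+ 2); apply: cvg_lim => //.
  under eq_fun do rewrite evol_partialE /=.
  apply: cvg_big => [|i _]; first exact: add_continuous; apply: cvgMr; rewrite unlock.
  exact: is_cvg_series_cos_coeff.
under eq_fun do rewrite evol_partialE /=.
apply: cvg_big => [|i _]; first exact: add_continuous; apply: cvgMr; rewrite unlock.
exact: is_cvg_series_sin_coeff.
Qed.
(** By the inequality between geometric and arithmetic means, as each vertex has total squared
    weight 1 in the frame. *)
Lemma frame_abs_le1 u v : \sum_i `|a i v * a i u| <= 1.
Proof.
have sq w : \sum_i a i w ^+ 2 = 1.
  transitivity ((w == w)%:R : R); last by rewrite eqxx.
  by rewrite -frame; apply: eq_bigr => i _; rewrite expr2.
have -> : 1 = \sum_i (a i v ^+ 2 + a i u ^+ 2) / 2 :> R.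
  by rewrite -mulr_suml big_split /= !sq; lra.
apply: ler_sum => i _; rewrite ler_norml.
have := sqr_ge0 (a i v - a i u); have := sqr_ge0 (a i v + a i u); lra.
Qed.

Lemma evol_cos_le1 t u v : `|evol_cos t v u| <= 1.
Proof.
apply: le_trans (frame_abs_le1 u v); apply: le_trans (ler_norm_sum _ _ _) _.
apply: ler_sum => i _; rewrite normrM ler_piMr // ler_norml.
by rewrite cos_geN1 cos_le1.
Qed.

Lemma evol_sin_le1 t u v : `|evol_sin t v u| <= 1.
Proof.
apply: le_trans (frame_abs_le1 u v); apply: le_trans (ler_norm_sum _ _ _) _.
apply: ler_sum => i _; rewrite normrM ler_piMr // ler_norml.
by rewrite sin_geN1 sin_le1.
Qed.

(** The amplitude is a combination of unit phases whose weights have absolute sum at most 1. The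
    double sum over phase differences is its squared modulus written without complex numbers. *)
Lemma amp2_le1 t u v : amp2 M t u v <= 1.
Proof.
rewrite amp2E; set C := evol_cos _ _ _; set S := evol_sin _ _ _.
have -> : C ^+ 2 + S ^+ 2 =
    \sum_i \sum_j (a i v * a i u) * (a j v * a j u) * cos (t * l i - t * l j).
  rewrite !expr2 /C /S /evol_cos /evol_sin !mulr_suml -big_split /=.
  apply: eq_bigr => i _; rewrite !mulr_sumr -big_split /=.
  by apply: eq_bigr => j _; rewrite cosB; ring.
apply: (@le_trans _ _ (\sum_i \sum_j `|a i v * a i u| * `|a j v * a j u|)).
  apply: ler_sum => i _; apply: ler_sum => j _; rewrite -normrM.
  apply: le_trans (ler_norm _) _; rewrite [leLHS]normrM ler_piMr // ler_norml.
  by rewrite cos_geN1 cos_le1.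
under eq_bigr => i _ do rewrite -mulr_sumr.
rewrite -mulr_suml -[leRHS]mulr1.
by apply: ler_pM; rewrite ?frame_abs_le1 // sumr_ge0.
Qed.

Section Eigenvector.
Variables (z : 'I_n -> R) (E : R).
Hypothesis zE : forall v, \sum_u M v u * z u = E * z v.
Hypothesis Msym : M^T = M.

Lemma frame_dotM (w : 'I_n -> R) i :
  \sum_v a i v * (\sum_u M v u * w u) = l i * \sum_v a i v * w v.
Proof.
under eq_bigr => v _ do rewrite mulr_sumr.
rewrite exchange_big /= mulr_sumr; apply: eq_bigr => u _.
rewrite mulrA -eig mulr_suml; apply: eq_bigr => v _.
by rewrite -{1}Msym mxE; ring.
Qed.

Lemma frame_sum (w : 'I_n -> R) v : \sum_i a i v * (\sum_u a i u * w u) = w v.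
Proof.
under eq_bigr => i _ do rewrite mulr_sumr.
rewrite exchange_big /= (bigD1 v) //= [X in _ + X]big1 => [|u uv].
  transitivity ((v == v)%:R * w v); last by rewrite eqxx mul1r.
  by rewrite addr0 -frame mulr_suml; apply: eq_bigr => i _; rewrite mulrA.
transitivity ((v == u)%:R * w u); last by rewrite eq_sym (negbTE uv) mul0r.
by rewrite -frame mulr_suml; apply: eq_bigr => i _; rewrite mulrA.
Qed.

(** Functional calculus: g(M) multiplies [z] by g(E), because only frame vectors with eigenvalue [E]
    can fail to be orthogonal to [z]. Leaving [g] arbitrary serves cosine and sine at once. *)
Lemma evol_eigen (g : R -> R) v :
  \sum_u (\sum_i a i v * a i u * g (l i)) * z u = g E * z v.
Proof.
under eq_bigr => u _ do rewrite mulr_suml.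
rewrite exchange_big /= -[in RHS](frame_sum z v) mulr_sumr.
apply: eq_bigr => i _.
transitivity (a i v * g (l i) * \sum_u a i u * z u).
  by rewrite mulr_sumr; apply: eq_bigr => u _; ring.
have [->|q0] := eqVneq (\sum_u a i u * z u) 0; first by rewrite !mulr0.
suff -> : l i = E by ring.
apply: (mulIf q0); rewrite -frame_dotM mulr_sumr; apply: eq_bigr => u _.
by rewrite zE; ring.
Qed.
End Eigenvector.

Lemma frame_parseval (w : 'I_n -> R) :
  \sum_i (\sum_v a i v * w v) ^+ 2 = \sum_v w v ^+ 2.
Proof.
transitivity (\sum_v w v * \sum_i a i v * (\sum_u a i u * w u)).
  under [RHS]eq_bigr => v _ do rewrite mulr_sumr.
  rewrite exchange_big /=; apply: eq_bigr => i _.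
  by rewrite expr2 mulr_suml; apply: eq_bigr => v _; ring.
by apply: eq_bigr => v _; rewrite frame_sum expr2.
Qed.
End Evolution.

(** The mean of [l i ^+ 2], weighted by the squared components of [w], is the quotient of the
    squared norms of [M w] and [w]. Some eigenvalue of positive weight therefore does not exceed
    it. *)
Lemma eigen_near (R : realType) (n : nat) (M : 'M[R]_n) (w : 'I_n -> R) :
  M^T = M -> 0 < \sum_v w v ^+ 2 ->
  exists (l : R) (z : 'I_n -> R),
    [/\ forall v, \sum_u M v u * z u = l * z v, \sum_v z v * w v != 0 &
        l ^+ 2 * \sum_v w v ^+ 2 <= \sum_v (\sum_u M v u * w u) ^+ 2].
Proof.
move=> Msym w0; have [l [a [eig fr]]] := symmetric_eigenframe Msym.
pose q i := \sum_v a i v * w v.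
have qq : \sum_i q i ^+ 2 = \sum_v w v ^+ 2 := frame_parseval fr w.
have lq : \sum_i (l i * q i) ^+ 2 = \sum_v (\sum_u M v u * w u) ^+ 2.
  by rewrite -(frame_parseval fr); apply: eq_bigr => i _; rewrite (frame_dotM eig).
set K := \sum_v (\sum_u _) ^+ 2 in lq *; set N := \sum_v w v ^+ 2 in w0 qq *.
have [[i qi li]|H] := pselect (exists2 i, q i != 0 & l i ^+ 2 * N <= K).
  by exists (l i), (a i).
exfalso; suff : K * N < K * N by rewrite ltxx.
have [j qj] : exists j, q j != 0.
  apply/not_existsP => q0; move: w0; rewrite -qq big1 ?ltxx // => i _.
  by have /negP := q0 i; rewrite negbK => /eqP ->; rewrite expr0n.
have step i : q i != 0 -> K * q i ^+ 2 < (l i * q i) ^+ 2 * N.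
  move=> qi; rewrite exprMn mulrAC ltr_pM2r ?exprn_even_gt0 //=.
  by rewrite ltNge; apply/negP => le; apply: H; exists i.
(* Both sides of [K * N < K * N] are expanded over the frame; index [j], with a nonzero component,
   makes the inequality strict. *)
rewrite -{1}qq -{2}lq mulr_sumr mulr_suml (bigD1 j) //= [ltRHS](bigD1 j) //=.
apply: ltr_leD; first exact: step.
apply: ler_sum => i _; have [->|/step/ltW//] := eqVneq (q i) 0.
by rewrite mulr0 expr0n mulr0 mul0r.
Qed.

(** * Graph distance and shortest walks *)

Section Distance.
Variables (n : nat) (e : rel 'I_n).

Lemma gdist_le (x y : 'I_n) p : path e x p -> last x p = y ->
  (gdist e x y <= size p)%N.
Proof.
move=> ep py; rewrite /gdist; set P := fun k => _.
(* A walk of length [n] or more is outside the range searched, but [find] never returns more than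
   [n]. *)
have [lt_pn|] := ltnP (size p) n; last first.
  by apply: leq_trans; rewrite -[X in (_ <= X)%N](size_iota 0 n) find_size.
rewrite leqNgt; apply/negP => /(before_find 0%N).
rewrite nth_iota // add0n /P => /negbT/negP; apply; apply/existsP.
by exists (in_tuple p); rewrite /= ep py eqxx.
Qed.

(** A walk without repeated vertices has length below [n], so the search in [gdist] succeeds. *)
Lemma gdist_path (x y : 'I_n) : connect e x y ->
  exists2 p, path e x p & last x p = y /\ size p = gdist e x y.
Proof.
move=> /connectP[p0 ep0 ->]; case: (shortenP ep0) => p ep up _.
set y0 := last x p; pose P k := [exists q : k.-tuple 'I_n, path e x q && (last x q == y0)].
have hasP : has P (iota 0 n).
  apply/hasP; exists (size p); last first.
    by apply/existsP; exists (in_tuple p); rewrite /= ep eqxx.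
  rewrite mem_iota add0n /=; have := max_card (mem (x :: p)).
  by rewrite (card_uniqP up) card_ord.
have := nth_find 0%N hasP; rewrite nth_iota ?add0n; last first.
  by rewrite -[X in (_ < X)%N](size_iota 0 n) -has_find.
move=> /existsP[q /andP[eq /eqP lq]]; exists q => //; split=> //.
by rewrite size_tuple.
Qed.

Hypothesis conn : connected_graph e.

Lemma gdist_eq0 (x y : 'I_n) : gdist e x y = 0%N -> x = y.
Proof. by have [p _ [<- <-]] := gdist_path (conn x y); case: p. Qed.

Lemma gdistxx (x : 'I_n) : gdist e x x = 0%N.
Proof. by apply/eqP; rewrite -leqn0; exact: (@gdist_le x x [::]). Qed.

Lemma gdist_edge (x s y : 'I_n) : e x s -> (gdist e x y <= (gdist e s y).+1)%N.
Proof.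
move=> xs; have [p ep [lp sp]] := gdist_path (conn s y).
by rewrite -sp; apply: (@gdist_le x y (s :: p)) => //=; rewrite xs.
Qed.

Lemma gdist_closer (x y : 'I_n) : x != y ->
  exists2 s, e x s & gdist e x y = (gdist e s y).+1.
Proof.
move=> xy; have [[|s p] /= ep [lp sp]] := gdist_path (conn x y).
  by rewrite lp eqxx in xy.
case/andP: ep => xs ep; exists s => //; apply/eqP; rewrite eqn_leq gdist_edge //=.
by rewrite -sp ltnS; apply: gdist_le.
Qed.

Lemma gdist_aut (s : 'I_n -> 'I_n) (x y : 'I_n) :
  graph_aut e s -> (gdist e (s x) (s y) <= gdist e x y)%N.
Proof.
move=> [_ es]; have [p ep [lp <-]] := gdist_path (conn x y).
rewrite -(size_map s); apply: gdist_le; last by rewrite last_map lp.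
by rewrite path_map; apply: sub_path ep => u v /=; rewrite es.
Qed.
End Distance.

(** * Decay of the half difference and exact order of the splitting *)

Section Splitting.
Variables (R : realType) (n : nat) (e : rel 'I_n) (x y : 'I_n).
Variables (A : 'I_n -> 'I_n -> R) (w : 'I_n -> R) (w0 w1 a0 K : R).
Hypothesis conn : connected_graph e.
Hypothesis xy : x != y.
Hypothesis A_ge0 : forall r s, 0 <= A r s.
Hypothesis A_le1 : forall r s, A r s <= 1.
Hypothesis A_edge : forall r s, e r s -> a0 <= A r s.
Hypothesis A_nedge : forall r s, ~~ e r s -> A r s = 0.
Hypothesis a0_gt0 : 0 < a0.
Hypothesis w0_gt0 : 0 < w0.
Hypothesis w_ge : forall r, r != x -> r != y -> w0 <= w r.
Hypothesis w1_ge0 : 0 <= w1.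
Hypothesis w_le : forall r, w r <= w1.
Let d := gdist e x y.

Definition interior r := (r != x) && (r != y).

(** Away from the two wells the diagonal coefficient is of order [Q], which is what each division by
    it gains; the threshold on [Q] lets [lam] consume at most half of [Q * w0]. *)
Lemma denominator_ge (Q lam : R) r : interior r -> 2 * K / w0 <= Q -> `|lam| <= K ->
  w0 / 2 * Q <= Q * w r - lam.
Proof.
move=> /andP[rx ry] HQ HK; have wr := w_ge rx ry.
rewrite ler_pdivrMr // in HQ.
have K0 : 0 <= K by apply: le_trans HK.
have Q0 : 0 <= Q by rewrite -(pmulr_lge0 _ w0_gt0); lra.
by have := ler_norm lam; have := ler_wpM2l Q0 wr; lra.
Qed.

Lemma norm_sum_A (f : 'I_n -> R) r c :
  (forall s, e r s -> `|f s| <= c) -> 0 <= c -> `|\sum_s A r s * f s| <= n%:R * c.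
Proof.
move=> fc c0; apply: le_trans (ler_norm_sum _ _ _) _.
have -> : n%:R * c = \sum_(s < n) c by rewrite sumr_const card_ord mulr_natl.
apply: ler_sum => s _; rewrite normrM ger0_norm //.
have [/fc fs|/A_nedge ->] := boolP (e r s); last by rewrite mul0r.
by have := A_ge0 r s; have := A_le1 r s; have := normr_ge0 (f s); nra.
Qed.

(** Summing the equation over interior vertices gives [w0 / 2 * Q * m <= n * (2 + m)], where 2 is
    the mass at [x] and [y]. The second threshold absorbs [n * m] into half of the left side. *)
Lemma interior_mass (Q lam : R) (p : 'I_n -> R) :
  2 * K / w0 <= Q -> 4 * n%:R / w0 <= Q -> `|lam| <= K ->
  `|p x| = 1 -> `|p y| = 1 ->
  (forall r, Q * w r * p r - \sum_s A r s * p s = lam * p r) ->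
  \sum_(r | interior r) `|p r| <= 8 * n%:R / w0 / Q.
Proof.
move=> QK Qn lamK px py eqp; set m := \sum_(r | _) _.
have n0 : 0 < n%:R :> R by rewrite ltr0n; exact: leq_ltn_trans (ltn_ord x).
have Q0 : 0 < Q by apply: lt_le_trans Qn; apply: divr_gt0 => //; lra.
have m0 : 0 <= m by apply: sumr_ge0.
have tot : \sum_r `|p r| = 2 + m.
  rewrite (bigD1 x) //= (bigD1 y) /= 1?eq_sym // px py addrA.
  by congr (_ + _); apply: eq_bigl => r; rewrite /interior.
have step r : interior r -> w0 / 2 * Q * `|p r| <= 2 + m.
  move=> ir; have den := denominator_ge ir QK lamK.
  apply: (@le_trans _ _ `|(Q * w r - lam) * p r|).
    by rewrite normrM ler_wpM2r //; apply: le_trans den _; exact: ler_norm.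
  have -> : (Q * w r - lam) * p r = \sum_s A r s * p s by have := eqp r; lra.
  rewrite -tot; apply: le_trans (ler_norm_sum _ _ _) _; apply: ler_sum => s _.
  by rewrite normrM ger0_norm // ler_piMl.
have : w0 / 2 * Q * m <= n%:R * (2 + m).
  have -> : n%:R * (2 + m) = \sum_(s < n) (2 + m) by rewrite sumr_const card_ord mulr_natl.
  rewrite mulr_sumr [leRHS](bigID interior) /= -[leLHS]addr0; apply: lerD.
    exact: ler_sum.
  by apply: sumr_ge0 => i _; lra.
move=> H; rewrite ler_pdivlMr // ler_pdivlMr //.
rewrite ler_pdivrMr // in Qn; nra.
Qed.

(* [al] and [be] are the half sum and half difference of the two eigenvectors, [lam]
   and [del] those of their eigenvalues. *)
Record doublet (Q lam del : R) (al be : 'I_n -> R) : Prop := Doublet {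
  doublet_QK : 2 * K / w0 <= Q;
  doublet_Q_gt0 : 0 < Q;
  doublet_lam : `|lam| <= K;
  doublet_al : forall r, `|al r| <= 1;
  doublet_be : forall r, `|be r| <= 1;
  doublet_be_x : be x = 0;
  doublet_be_y : be y = 1;
  doublet_interior : forall r, interior r ->
    (Q * w r - lam) * be r = \sum_s A r s * be s + del * al r;
  doublet_del : \sum_s A x s * be s = - del }.

(** Cost of [j] steps away from [y]: at each one the neighbours and the splitting both contribute
    [n] times the previous bound, and the sum is divided by [w0 / 2]. *)
Definition decay_const j : R := (4 * n%:R / w0) ^+ j.
Local Notation C := decay_const.

Lemma decay_const_ge0 j : 0 <= C j.
Proof. by apply: exprn_ge0; apply: divr_ge0; [apply: mulr_ge0|exact: ltW]. Qed.

Section Quantities.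
Variables (Q lam del : R) (al be : 'I_n -> R).
Hypothesis D : doublet Q lam del al be.
Let QK := doublet_QK D.
Let Q_gt0 := doublet_Q_gt0 D.
Let lamK := doublet_lam D.
Let al_le1 := doublet_al D.
Let be_le1 := doublet_be D.
Let be_x := doublet_be_x D.
Let be_in := doublet_interior D.
Let be_del := doublet_del D.

(** The equation at [x] expresses [del] through the neighbours of [x], all at distance at least
    [d - 1 >= j] from [y]. *)
Lemma splitting_le_of_decay j : (j < d)%N ->
  (forall r, (j <= gdist e r y)%N -> `|be r| * Q ^+ j <= C j) ->
  `|del| * Q ^+ j <= n%:R * C j.
Proof.
move=> jd H; have Qj : 0 < Q ^+ j by rewrite exprn_gt0.
have -> : `|del| = `|\sum_s A x s * be s| by rewrite be_del normrN.
rewrite -ler_pdivlMr // -mulrA; apply: norm_sum_A => [s xs|]; last first.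
  by rewrite divr_ge0 ?decay_const_ge0 // ltW.
rewrite ler_pdivlMr //; apply: H.
by have := gdist_edge conn y xs; rewrite -/d => h; rewrite -ltnS; apply: leq_trans jd h.
Qed.

(** Induction on [j], run jointly with the bound on [del]: level [j] controls both the neighbours of
    [r] and the source term [del * al r]. The source term confines the argument to [j <= d]. *)
Lemma amplitude_decay j r : (j <= d)%N -> (j <= gdist e r y)%N ->
  `|be r| * Q ^+ j <= C j.
Proof.
elim: j r => [|j IH] r jd jr; first by rewrite /C !expr0 mulr1.
have [->|rx] := eqVneq r x; first by rewrite be_x normr0 mul0r decay_const_ge0.
have ry : r != y by apply: contraTneq jr => ->; rewrite gdistxx.
have ir : interior r by apply/andP.
have den := denominator_ge ir QK lamK.
have Qj : 0 < Q ^+ j by rewrite exprn_gt0.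
have dl := splitting_le_of_decay jd (fun r => IH r (ltnW jd)).
have Cj := decay_const_ge0 j.
have sm : `|\sum_s A r s * be s| * Q ^+ j <= n%:R * C j.
  rewrite -ler_pdivlMr // -mulrA; apply: norm_sum_A => [s rs|]; last first.
    by rewrite divr_ge0 // ltW.
  rewrite ler_pdivlMr //; apply: IH; first exact: ltnW.
  by rewrite -ltnS; apply: leq_trans jr (gdist_edge conn y rs).
have low : w0 / 2 * Q * `|be r| <= `|\sum_s A r s * be s| + `|del|.
  apply: (@le_trans _ _ `|(Q * w r - lam) * be r|).
    rewrite normrM ler_wpM2r //; apply: le_trans den _; exact: ler_norm.
  rewrite be_in //; apply: le_trans (ler_normD _ _) _; rewrite lerD2l normrM.
  by rewrite ler_piMr.
have -> : C j.+1 = 4 * n%:R * C j / w0 by rewrite /C exprS; ring.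
rewrite ler_pdivlMr // exprS.
have := ler_wpM2r (ltW Qj) low; rewrite mulrDl; nra.
Qed.

Lemma splitting_le : `|del| * Q ^+ d.-1 <= n%:R * C d.-1.
Proof.
have d0 : (0 < d)%N by rewrite lt0n; apply: contra xy => /eqP/(gdist_eq0 conn) ->.
apply: splitting_le_of_decay => [|r]; first by rewrite prednK.
by apply: amplitude_decay; rewrite leq_pred.
Qed.

(** Neighbours of [r] at distance [j] from [y] exist and contribute positively, at least [a0 * c]
    for one of them. All others are farther away, hence smaller by a factor [1 / Q], whatever their
    sign. *)
Lemma neighbour_sum_ge j r c : 0 <= c -> (j < d)%N -> gdist e r y = j.+1 ->
  (forall s, gdist e s y = j -> c <= be s * Q ^+ j) ->
  a0 * c - n%:R * C j.+1 / Q <= (\sum_s A r s * be s) * Q ^+ j.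
Proof.
move=> c0 jd rj H.
have [s0 rs0 s0j] : exists2 s, e r s & gdist e r y = (gdist e s y).+1.
  by apply: gdist_closer => //; apply: contra_eq_neq rj => ->; rewrite gdistxx.
have {}s0j : gdist e s0 y = j by apply: succn_inj; rewrite -s0j.
have Qj : 0 < Q ^+ j by rewrite exprn_gt0.
set b := C j.+1 / Q; have b0 : 0 <= b by rewrite divr_ge0 ?decay_const_ge0 // ltW.
have each s : - b <= A r s * be s * Q ^+ j.
  have [rs|/A_nedge ->] := boolP (e r s); last by rewrite !mul0r oppr_le0.
  have [sj|sj] := eqVneq (gdist e s y) j.
    by rewrite -mulrA (le_trans _ (mulr_ge0 _ (le_trans c0 (H s sj)))) // oppr_le0.
  have js : (j < gdist e s y)%N.
    by rewrite ltn_neqAle eq_sym sj -ltnS -rj gdist_edge.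
  have := amplitude_decay jd js.
  have -> : `|be s| * Q ^+ j.+1 = `|be s * Q ^+ j| * Q.
    by rewrite normrM (ger0_norm (ltW Qj)) exprSr mulrA.
  rewrite -ler_pdivlMr // -/b ler_norml -mulrA => /andP[lo _].
  by have := A_ge0 r s; have := A_le1 r s; nra.
rewrite mulr_suml (bigD1 s0) //= -mulrA -/b.
have h0 : a0 * c <= A r s0 * be s0 * Q ^+ j.
  rewrite -mulrA; apply: ler_pM => //; [exact: ltW|exact: A_edge|exact: H].
apply: lerD => //.
have -> : - (n%:R * b) = \sum_(s < n) - b by rewrite sumr_const card_ord mulr_natl mulNrn.
rewrite [leLHS](bigD1 s0) //= -[leRHS]add0r; apply: lerD; first by rewrite oppr_le0.
exact: ler_sum.
Qed.
End Quantities.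

(** Induction along the distance to [y]. Before [x] is reached, the source term [del * al r] is one
    power of [Q] below the neighbour sum and cannot cancel it. The constants are fixed before [Q]
    and the doublet, hence uniform in them. *)
Lemma amplitude_ge j : (j < d)%N ->
  exists2 c, 0 < c & exists Q0, forall Q lam del al be,
    doublet Q lam del al be -> Q0 <= Q ->
    forall r, gdist e r y = j -> c <= be r * Q ^+ j.
Proof.
elim: j => [|j IH] jd.
  exists 1 => //; exists 0 => Q lam del al be D _ r /(gdist_eq0 conn) ->.
  by rewrite (doublet_be_y D) mulr1.
have [c c0 [Q0 H]] := IH (ltnW jd).
have ac0 : 0 < a0 * c by rewrite mulr_gt0.
have w1_gt0 : 0 < 1 + w1 by rewrite ltr_wpDr.
(* The remote neighbours and the source term each lose at most [a0 * c / 4], leaving [a0 * c / 2];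
   the diagonal coefficient is at most [Q * (1 + w1)] once [K <= Q]. *)
exists (a0 * c / 2 / (1 + w1)); first by rewrite !divr_gt0.
exists (Num.max Q0 (Num.max K (4 * n%:R * C j.+1 / (a0 * c)))).
move=> Q lam del al be D; rewrite !ge_max => /and3P[QQ0 QK Qc] r rj.
have Q_gt0 := doublet_Q_gt0 D.
have Qj : 0 < Q ^+ j by rewrite exprn_gt0.
have ns := neighbour_sum_ge D (ltW c0) (ltnW jd) rj (H _ _ _ _ _ D QQ0).
have rx : r != x.
  by apply: contraTneq jd => rx; rewrite -rj rx -leqNgt.
have ry : r != y by apply: contra_eq_neq rj => ->; rewrite gdistxx.
have ir : interior r by apply/andP.
have dl := splitting_le_of_decay D jd (fun r => amplitude_decay D (ltnW jd)).
have eqr := doublet_interior D ir.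
have dal : - (n%:R * C j.+1 / Q) <= del * al r * Q ^+ j.
  have : `|del * al r * Q ^+ j| <= n%:R * C j.+1 / Q.
    rewrite ler_pdivlMr //; apply: le_trans dl.
    have -> : `|del * al r * Q ^+ j| * Q = `|del| * Q ^+ j.+1 * `|al r|.
      by rewrite !normrM (ger0_norm (ltW Qj)) exprSr; ring.
    by rewrite ler_piMr ?(doublet_al D) // mulr_ge0 // exprn_ge0 // ltW.
  by rewrite ler_norml => /andP[].
have Qc' : n%:R * C j.+1 / Q <= a0 * c / 4.
  rewrite ler_pdivrMr //; move: Qc; rewrite ler_pdivrMr //; lra.
have prod : a0 * c / 2 <= (Q * w r - lam) * (be r * Q ^+ j).
  by rewrite mulrA eqr mulrDl; lra.
have K0 : 0 <= K := le_trans (normr_ge0 _) (doublet_lam D).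
have den := denominator_ge ir (doublet_QK D) (doublet_lam D).
have wQ : 0 < w0 / 2 * Q by rewrite mulr_gt0 // divr_gt0.
have b0 : 0 <= be r * Q ^+ j.
  rewrite -(pmulr_rge0 _ (lt_le_trans wQ den)); apply: le_trans prod.
  by rewrite divr_ge0 // ltW.
have upp : Q * w r - lam <= Q * (1 + w1).
  have := ler_wpM2l (ltW Q_gt0) (w_le r).
  by have := ler_norm (- lam); rewrite normrN; have := doublet_lam D; lra.
have fin := le_trans prod (ler_wpM2r b0 upp).
by rewrite ler_pdivrMr // exprSr; lra.
Qed.

(** The equation at [x] equates [- del] with a neighbour sum at distance [d] from [y], whose leading
    part is positive by [amplitude_ge]. *)
Lemma splitting_ge :
  exists2 c, 0 < c & exists Q0, forall Q lam del al be,
    doublet Q lam del al be -> Q0 <= Q -> c <= `|del| * Q ^+ d.-1.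
Proof.
have d0 : (0 < d)%N by rewrite lt0n; apply: contra xy => /eqP/(gdist_eq0 conn) ->.
have [|c c0 [Q0 H]] := @amplitude_ge d.-1; first by rewrite prednK.
have ac0 : 0 < a0 * c by rewrite mulr_gt0.
exists (a0 * c / 2); first by rewrite divr_gt0.
exists (Num.max Q0 (2 * n%:R * C d / (a0 * c))).
move=> Q lam del al be D; rewrite ge_max => /andP[QQ0 Qc].
have Q_gt0 := doublet_Q_gt0 D.
have [jd rj] : (d.-1 < d)%N /\ gdist e x y = d.-1.+1 by rewrite prednK.
have := neighbour_sum_ge D (ltW c0) jd rj (H _ _ _ _ _ D QQ0).
have Qc' : n%:R * C d / Q <= a0 * c / 2.
  by rewrite ler_pdivrMr //; move: Qc; rewrite ler_pdivrMr //; lra.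
rewrite (doublet_del D) prednK //; move: Qc'; rewrite -[X in X <= _ -> _]/(_ / Q).
have := ler_wpM2r (exprn_ge0 d.-1 (ltW Q_gt0)) (ler_norm (- del)).
by rewrite normrN; lra.
Qed.
End Splitting.

(** * From the graph Hamiltonian to a two-level system *)

Section Graph.
Variables (R : realType) (n : nat) (e : rel 'I_n) (W : 'I_n -> R) (x y : 'I_n).
Variable (sigma : 'I_n -> 'I_n).
Hypothesis simple : simple_graph e.
Hypothesis conn : connected_graph e.
Hypothesis xy : x != y.
Hypothesis W_max : forall v, W v <= W x.
Hypothesis W_y : W y = W x.
Hypothesis W_unique : forall v, W v = W x -> v = x \/ v = y.
Hypothesis aut : graph_aut e sigma.
Hypothesis sigmaK : forall v, sigma (sigma v) = v.
Hypothesis sigma_x : sigma x = y.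
Hypothesis W_sigma : forall v, W (sigma v) = W v.

Let deg := @degree R n e.
Definition adj r s : R := if e r s then (Num.sqrt (deg r * deg s))^-1 else 0.
Let w r := W x - W r.

Lemma n_gt0 : 0 < n%:R :> R.
Proof. by rewrite ltr0n; exact: leq_ltn_trans (ltn_ord x). Qed.

Lemma adj_ge0 r s : 0 <= adj r s.
Proof. by rewrite /adj; case: ifP => // _; rewrite invr_ge0 sqrtr_ge0. Qed.

(* [degree] counts a classical set; [finset] is its decidable counterpart. *)
Lemma degreeE v : deg v = #|finset (e v)|%:R.
Proof.
rewrite /deg /degree; congr (_%:R); apply: eq_card => u; rewrite [RHS]inE.
by apply/idP/idP; rewrite in_setE.
Qed.

Lemma degree_ge1 r s : e r s -> 1 <= deg r.
Proof.
by move=> rs; rewrite degreeE ler1n card_gt0; apply/set0Pn; exists s; rewrite inE.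
Qed.

Lemma adj_le1 r s : adj r s <= 1.
Proof.
rewrite /adj; case: ifP => // rs; have dr := degree_ge1 rs.
have ds : 1 <= deg s by apply: (@degree_ge1 _ r); rewrite (proj1 simple).
rewrite invf_le1; last by rewrite sqrtr_gt0; nra.
by rewrite -sqrtr1 ler_wsqrtr //; nra.
Qed.

(** Both degrees are at most [n]. *)
Lemma adj_edge r s : e r s -> n%:R^-1 <= adj r s.
Proof.
rewrite /adj => rs; rewrite rs; have dr := degree_ge1 rs.
have ds : 1 <= deg s by apply: (@degree_ge1 _ r); rewrite (proj1 simple).
rewrite lef_pV2 ?posrE ?n_gt0 //; last by rewrite sqrtr_gt0; nra.
have -> : n%:R = Num.sqrt (n%:R ^+ 2) :> R by rewrite sqrtr_sqr ger0_norm.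
have le_n v : deg v <= n%:R by rewrite degreeE ler_nat -[leqRHS]card_ord max_card.
rewrite ler_wsqrtr // expr2; apply: ler_pM => //; lra.
Qed.

Lemma adj_nedge r s : ~~ e r s -> adj r s = 0.
Proof. by rewrite /adj => /negbTE ->. Qed.

Lemma degree_aut v : deg (sigma v) = deg v.
Proof.
rewrite !degreeE; congr (_%:R).
rewrite -(card_preimset (finset (e (sigma v))) (bij_inj (proj1 aut))).
by apply: eq_card => u; rewrite !inE (proj2 aut).
Qed.

Lemma adj_aut r s : adj (sigma r) (sigma s) = adj r s.
Proof. by rewrite /adj (proj2 aut) !degree_aut. Qed.

Lemma hamiltonian_row Q v (z : 'I_n -> R) :
  \sum_u hamiltonian e W Q v u * z u = (1 - Q * W v) * z v - \sum_u adj v u * z u.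
Proof.
have adjvv : adj v v = 0 by rewrite adj_nedge // (proj2 simple).
rewrite (bigD1 v) //= [X in _ - X](bigD1 v) //= adjvv mul0r add0r !mxE eqxx.
rewrite mulr1n -sumrN; congr (_ + _); apply: eq_bigr => u uv.
rewrite !mxE eq_sym (negbTE uv) mulr0n mulr0 subr0 /adj.
by case: ifP => _; rewrite ?mulNr ?mul0r ?oppr0.
Qed.

Lemma hamiltonian_sym Q : (hamiltonian e W Q)^T = hamiltonian e W Q.
Proof.
apply/matrixP => u v; rewrite !mxE eq_sym (proj1 simple v u) (mulrC (degree _ _ v)).
by have [->|] := eqVneq u v; rewrite ?mulr0n.
Qed.

(** After the energy shift the potential vanishes at both wells, so the image of
    [f = chi_x + eps chi_y] is bounded independently of [Q] and [eigen_near] applies. Symmetrising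
    by [sigma] then ties the values at [x] and [y]. *)
Lemma doublet_eigenvector Q (eps : R) : eps * eps = 1 ->
  exists lam (p : 'I_n -> R), [/\ `|lam| <= 2 * n%:R, p x = 1, p y = eps &
    forall v, Q * w v * p v - \sum_u adj v u * p u = lam * p v].
Proof.
move=> ee; pose M := hamiltonian e W Q - (1 - Q * W x)%:M.
have rowM z v : \sum_u M v u * z u = Q * w v * z v - \sum_u adj v u * z u.
  transitivity (\sum_u hamiltonian e W Q v u * z u - (1 - Q * W x) * z v).
    rewrite (bigD1 v) //= [in RHS](bigD1 v) //= /M !mxE eqxx !mulr1n.
    rewrite (eq_bigr (fun u => hamiltonian e W Q v u * z u)); first by ring.
    by move=> u uv; rewrite !mxE [v == u]eq_sym (negbTE uv) !mulr0n subr0.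
  by rewrite hamiltonian_row /w; ring.
have Msym : M^T = M by rewrite /M linearB /= tr_scalar_mx hamiltonian_sym.
pose f v : R := (v == x)%:R + eps * (v == y)%:R.
have sumf (g : 'I_n -> R) : \sum_v g v * f v = g x + eps * g y.
  rewrite (bigD1 x) //= (bigD1 y) /= 1?eq_sym // big1 => [|v /andP[vx vy]].
    by rewrite /f !eqxx [y == x]eq_sym (negbTE xy) /= ?mulr1n ?mulr0n; ring.
  by rewrite /f (negbTE vx) (negbTE vy) /= mulr0n; ring.
have ff : \sum_v f v ^+ 2 = 2.
  under eq_bigr => v _ do rewrite expr2.
  by rewrite sumf /f !eqxx [y == x]eq_sym (negbTE xy) !mulr0 addr0 add0r mulr1 ee.
have [|lam [z [zeig zf lamf]]] := eigen_near (w := f) Msym; first by rewrite ff.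
(* Each of the [n] entries of [M f] is at most 2 in absolute value, while [f] has squared norm 2. *)
have {}lamf : lam ^+ 2 * 2 <= 4 * n%:R.
  move: lamf; rewrite ff => /le_trans; apply.
  have -> : 4 * n%:R = \sum_(v < n) 4 :> R by rewrite sumr_const card_ord mulr_natr.
  apply: ler_sum => v _; rewrite rowM sumf.
  have -> : Q * w v * f v = 0.
    rewrite /f /w; have [->|vx] := eqVneq v x; first by rewrite subrr; ring.
    by have [->|vy] := eqVneq v y; rewrite ?W_y ?subrr /= ?mulr0n; ring.
  have := adj_ge0 v x; have := adj_le1 v x; have := adj_ge0 v y; have := adj_le1 v y.
  have /orP[/eqP ->|/eqP ->] : (eps == 1) || (eps == -1).
    by rewrite -sqrf_eq1 expr2 ee.
  - by nra.
  - by nra.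
have lamn : `|lam| <= 2 * n%:R.
  have n1 : 1 <= n%:R :> R by rewrite ler1n -(ltr0n R) n_gt0.
  rewrite -(@ler_pXn2r _ 2) ?nnegrE // ?mulr_ge0 //.
  by rewrite -normrX ger0_norm ?sqr_ge0 //; nra.
pose q v := z v + eps * z (sigma v).
have sigma_y : sigma y = x by rewrite -sigma_x sigmaK.
(* [q x] is exactly the inner product of [z] and [f], so normalising by it is possible. *)
have qx0 : q x != 0 by move: zf; rewrite sumf /q sigma_x.
have qy : q y = eps * q x.
  by rewrite /q sigma_x sigma_y mulrDr mulrA ee mul1r addrC.
exists lam, (fun v => q v / q x); split => //; first by rewrite divff.
  by rewrite qy mulfK.
move=> v; have zs : Q * w v * z (sigma v) - \sum_u adj v u * z (sigma u) = lam * z (sigma v).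
  rewrite -zeig rowM /w W_sigma; congr (_ - _).
  rewrite [RHS](reindex_inj (bij_inj (proj1 aut))) /=.
  by apply: eq_bigr => u _; rewrite adj_aut.
have zv := zeig v; rewrite rowM in zv.
transitivity ((Q * w v * q v - \sum_u adj v u * q u) / q x).
  rewrite mulrBl mulr_suml mulrA; congr (_ - _).
  by apply: eq_bigr => u _; rewrite mulrA.
rewrite mulrA; congr (_ / _).
have -> : \sum_u adj v u * q u =
    \sum_u adj v u * z u + eps * \sum_u adj v u * z (sigma u).
  by rewrite mulr_sumr -big_split; apply: eq_bigr => u _; rewrite /q /=; ring.
have := congr1 (fun c => eps * c) zs; rewrite /q /=; lra.
Qed.

Lemma gap_exists : exists2 w0, 0 < w0 & forall r, r != x -> r != y -> w0 <= w r.
Proof.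
(* The default value 1 keeps the minimum positive even if there are no interior vertices. *)
exists (\big[Num.min/1]_(r | interior x y r) w r).
  apply: lt_bigmin => // r /andP[rx ry]; rewrite subr_gt0 lt_neqAle W_max andbT.
  by apply: contra rx => /eqP/W_unique [->//|ry']; rewrite ry' eqxx in ry.
by move=> r rx ry; apply: bigmin_le_cond; rewrite /interior rx ry.
Qed.

(** Up to an error uniform in [t], the transition amplitude is the beat of two phases. One constant
    [C] bounds both the scaled splitting and the error. *)
Lemma two_level_approximation :
  exists c C Q0 : R, [/\ 0 < c, 0 < C, 0 < Q0 & forall Q, Q0 <= Q ->
    exists Ep Em : R,
      c <= `|Ep - Em| * Q ^+ (gdist e x y).-1 <= C /\
      forall t, exists X Y : R,
        [/\ amp2 (hamiltonian e W Q) t x y = X ^+ 2 + Y ^+ 2,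
            `|X - (cos (t * Ep) - cos (t * Em)) / 2| <= C / Q &
            `|Y - (sin (t * Ep) - sin (t * Em)) / 2| <= C / Q]].
Proof.
have [w0 w0_gt0 w_ge] := gap_exists.
pose w1 := \sum_r w r; pose K := 2 * n%:R : R; pose a0 := n%:R^-1 : R.
have w_ge0 r : 0 <= w r by rewrite subr_ge0.
have w1_ge0 : 0 <= w1 by apply: sumr_ge0.
have w_le r : w r <= w1 by rewrite /w1 (bigD1 r) //= lerDl sumr_ge0.
have n0 := n_gt0.
have a0_gt0 : 0 < a0 by rewrite invr_gt0.
have [c c0 [Q1 low]] := splitting_ge K conn xy adj_ge0 adj_le1 adj_edge adj_nedge
  a0_gt0 w0_gt0 w_ge w1_ge0 w_le.
pose Cd := n%:R * decay_const n w0 (gdist e x y).-1.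
have Cd0 : 0 <= Cd by rewrite mulr_ge0 ?decay_const_ge0 // ltW.
pose eta := 8 * n%:R / w0; have eta0 : 0 < eta by rewrite divr_gt0 // mulr_gt0.
(* The factors 2 come from [Ep - Em = 2 * del]. The threshold [eta] implies both requirements of
   [interior_mass] and keeps the interior values of the eigenvectors at most 1. *)
exists (2 * c), (2 * Cd + eta), (Num.max Q1 eta); split.
- by rewrite mulr_gt0.
- by rewrite ltr_wpDl // mulr_ge0.
- by rewrite lt_max eta0 orbT.
move=> Q; rewrite ge_max => /andP[QQ1 Qeta].
have Q_gt0 : 0 < Q := lt_le_trans eta0 Qeta.
have QK : 2 * K / w0 <= Q.
  by apply: le_trans Qeta; rewrite /eta ler_pM2r ?invr_gt0 // /K; lra.
have Qn : 4 * n%:R / w0 <= Q.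
  by apply: le_trans Qeta; rewrite /eta ler_pM2r ?invr_gt0 //; lra.
have [|lp [p [lpK px py peq]]] := @doublet_eigenvector Q 1; first by rewrite mulr1.
have [|lm [m [lmK mx my meq]]] := @doublet_eigenvector Q (-1); first by rewrite mulrNN mulr1.
have mass := interior_mass xy adj_ge0 adj_le1 w0_gt0 w_ge QK Qn.
have pmass := mass lp p lpK; rewrite px py normr1 in pmass.
have {}pmass := pmass erefl erefl peq.
have mmass := mass lm m lmK; rewrite mx my normrN1 normr1 in mmass.
have {}mmass := mmass erefl erefl meq.
have etaQ1 : eta / Q <= 1 by rewrite ler_pdivrMr // mul1r.
have le1 (z : 'I_n -> R) : `|z x| = 1 -> `|z y| = 1 ->
    \sum_(r | interior x y r) `|z r| <= eta / Q -> forall r, `|z r| <= 1.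
  move=> zx zy zmass r; have [->|rx] := eqVneq r x; first by rewrite zx.
  have [->|ry] := eqVneq r y; first by rewrite zy.
  apply: le_trans etaQ1; apply: le_trans zmass.
  by rewrite (bigD1 r) /= ?lerDl ?sumr_ge0 //; apply/andP.
have p1 : forall r, `|p r| <= 1 by apply: le1; rewrite ?px ?py ?normr1.
have m1 : forall r, `|m r| <= 1 by apply: le1; rewrite ?mx ?my ?normrN1 ?normr1.
pose al v := (p v + m v) / 2; pose be v := (p v - m v) / 2.
pose lam := (lp + lm) / 2; pose del := (lp - lm) / 2.
have beeq v : Q * w v * be v - \sum_u adj v u * be u = lam * be v + del * al v.
  have -> : \sum_u adj v u * be u =
      (\sum_u adj v u * p u - \sum_u adj v u * m u) / 2.
    by rewrite -sumrB mulr_suml; apply: eq_bigr => u _; rewrite /be; ring.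
  have := peq v; have := meq v; rewrite /be /al /lam /del; lra.
have D : doublet x y adj w w0 K Q lam del al be.
  split=> //.
  - move: lpK lmK; rewrite -/K !ler_norml /lam => /andP[? ?] /andP[? ?].
    by apply/andP; split; lra.
  - move=> r; move: (p1 r) (m1 r); rewrite !ler_norml /al => /andP[? ?] /andP[? ?].
    by apply/andP; split; lra.
  - move=> r; move: (p1 r) (m1 r); rewrite !ler_norml /be => /andP[? ?] /andP[? ?].
    by apply/andP; split; lra.
  - by rewrite /be px mx subrr mul0r.
  - by rewrite /be py my; lra.
  - by move=> r _; have := beeq r; lra.
  - by have := beeq x; rewrite /be /al px mx /w subrr; lra.
(* Undoing the energy shift gives the eigenvalues of the Hamiltonian itself. *)
pose s := 1 - Q * W x; exists (lp + s), (lm + s).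
have -> : lp + s - (lm + s) = 2 * del by rewrite /del; lra.
rewrite normrM [`|2|]ger0_norm // -mulrA; split.
  have lo := low _ _ _ _ _ D QQ1.
  have hi := splitting_le conn xy adj_ge0 adj_le1 adj_nedge w0_gt0 w_ge D.
  rewrite -/Cd in hi.
  by apply/andP; split; lra.
move=> t; have Msym := hamiltonian_sym Q.
have [l [a [eig fr]]] := symmetric_eigenframe Msym.
(* [G] is row [y] of g(H). Applied to [al], it yields the half difference of the phases; since
   [al x = 1] and [al y = 0], this is [G x] up to the interior mass. *)
have approx (g : R -> R) : (forall u, `|\sum_i a i y * a i u * g (l i)| <= 1) ->
  `|\sum_i a i y * a i x * g (l i) - (g (lp + s) - g (lm + s)) / 2| <= eta / Q.
  move=> g1; pose G u := \sum_i a i y * a i u * g (l i).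
  have Heig lz z : (forall v, Q * w v * z v - \sum_u adj v u * z u = lz * z v) ->
      forall v, \sum_u hamiltonian e W Q v u * z u = (lz + s) * z v.
    by move=> zeq v; rewrite hamiltonian_row; have := zeq v; rewrite /s /w; lra.
  have Gp : \sum_u G u * p u = g (lp + s).
    by rewrite (evol_eigen eig fr (Heig _ _ peq) Msym) py mulr1.
  have Gm : \sum_u G u * m u = - g (lm + s).
    by rewrite (evol_eigen eig fr (Heig _ _ meq) Msym) my mulrN1.
  have Gal : \sum_u G u * al u = (g (lp + s) - g (lm + s)) / 2.
    rewrite -Gp -[- g _]Gm -big_split mulr_suml; apply: eq_bigr => u _.
    by rewrite /al /=; ring.
  have split : \sum_u G u * al u = G x + \sum_(u | interior x y u) G u * al u.
    rewrite (bigD1 x) //= (bigD1 y) /= 1?eq_sym // /al px mx py my subrr mul0r mulr0.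
    by rewrite add0r; congr (_ + _); lra.
  rewrite -Gal split -/(G x) opprD addrA subrr add0r normrN.
  apply: le_trans (ler_norm_sum _ _ _) _.
  apply: (@le_trans _ _ (\sum_(u | interior x y u) (`|p u| + `|m u|) / 2)).
    apply: ler_sum => u _; rewrite normrM.
    apply: le_trans (ler_piMl (normr_ge0 _) (g1 u)) _.
    by rewrite /al normrM [`|2^-1|]ger0_norm // ler_pM2r // ler_normD.
  by rewrite -mulr_suml big_split /=; rewrite -/eta in pmass mmass; lra.
have toC : eta / Q <= (2 * Cd + eta) / Q.
  by rewrite ler_pM2r ?invr_gt0 // lerDr mulr_ge0.
exists (evol_cos l a t y x), (evol_sin l a t y x); split; first exact: amp2E.
- apply: le_trans toC; apply: (approx (fun E => cos (t * E))) => u.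
  exact: evol_cos_le1.
- apply: le_trans toC; apply: (approx (fun E => sin (t * E))) => u.
  exact: evol_sin_le1.
Qed.
End Graph.

(** * Lipschitz bounds and lower limits at infinity *)

Section RealFacts.
Variable R : realType.

Lemma cos_lipschitz (u v : R) : `|cos u - cos v| <= `|u - v|.
Proof.
wlog le_uv : u v / u <= v.
  by move=> H; case/orP: (le_total u v) => /H //; rewrite distrC [leRHS]distrC.
have cc : {within `[u, v], continuous (cos : R -> R)}%classic.
  exact/continuous_subspaceT/continuous_cos.
have [z _ eqz] := MVT_segment le_uv (fun r _ => is_derive_cos r) cc.
rewrite distrC eqz normrM [leRHS]distrC ler_piMl // ler_norml.
by have := sin_geN1 z; have := sin_le1 z => ? ?; apply/andP; split; lra.
Qed.

Lemma sin_lipschitz (u v : R) : `|sin u - sin v| <= `|u - v|.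
Proof. by rewrite -!cosBpihalf (le_trans (cos_lipschitz _ _)) // opprB addrA subrK. Qed.

Lemma limf_einf_pinfty_le (f : R -> \bar R) (c : \bar R) :
  (\forall Q \near pinfty_nbhs R, (f Q <= c)%E) ->
  (limf_einf f (pinfty_nbhs R) <= c)%E.
Proof.
move=> fc; rewrite limf_einfE; apply: ge_ereal_sup => _ [V FV <-].
have [Q [VQ fQ]] : (V `&` [set Q | f Q <= c]%E !=set0)%classic.
  exact/(@filter_ex _ (pinfty_nbhs R))/filterI.
by apply: le_trans fQ; apply: ereal_inf_lbound; exists Q.
Qed.

Lemma limf_einf_pinfty_ge (f : R -> \bar R) (c : \bar R) :
  (\forall Q \near pinfty_nbhs R, (c <= f Q)%E) ->
  (c <= limf_einf f (pinfty_nbhs R))%E.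
Proof.
move=> fc; rewrite limf_einfE; apply: ereal_sup_ge.
exists (ereal_inf (f @` [set Q | c <= f Q]%E))%classic.
  by exists [set Q | c <= f Q]%E%classic.
by apply: le_ereal_inf_tmp => _ [Q cQ <-].
Qed.

Lemma near_pinfty_ge (Q0 : R) (P : R -> Prop) :
  (forall Q, Q0 <= Q -> P Q) -> \forall Q \near pinfty_nbhs R, P Q.
Proof. by move=> H; exists Q0; split => [|Q /ltW/H//]; exact: num_real. Qed.
End RealFacts.

(** * Perfect tunneling and its time scale *)

Section Tunneling.
Variables (R : realType) (n : nat) (e : rel 'I_n) (W : 'I_n -> R) (x y : 'I_n).
Variable (sigma : 'I_n -> 'I_n).
Hypothesis simple : simple_graph e.
Hypothesis conn : connected_graph e.
Hypothesis xy : x != y.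
Hypothesis W_max : forall v, W v <= W x.
Hypothesis W_y : W y = W x.
Hypothesis W_unique : forall v, W v = W x -> v = x \/ v = y.
Hypothesis aut : graph_aut e sigma.
Hypothesis sigmaK : forall v, sigma (sigma v) = v.
Hypothesis sigma_x : sigma x = y.
Hypothesis W_sigma : forall v, W (sigma v) = W v.
Let g (Q : R) := Q ^+ (gdist e x y).-1.

Lemma liminf_sup_le1 u v T : (liminf_sup e W u v T <= 1)%E.
Proof.
apply: limf_einf_pinfty_le; apply: (@near_pinfty_ge _ 0) => Q _.
apply: ge_ereal_sup => _ [t _ <-]; rewrite lee_fin.
have [l [a [eig fr]]] := symmetric_eigenframe (hamiltonian_sym W simple Q).
exact: amp2_le1 eig fr _ _ _.
Qed.

(** At time [pi / |Ep - Em|] the two phases are opposite and the beat has modulus 1. A general [T]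
    covers the unbounded window and the window of length [C * g Q] together. *)
Lemma liminf_sup_ge1 : exists2 C, 0 < C & forall T : R -> set R,
  (forall Q t, 0 <= t -> t <= C * g Q -> T Q t) -> (1 <= liminf_sup e W x y T)%E.
Proof.
have [c [C [Q0 [c0 C0 Q0_gt0 H]]]] := two_level_approximation simple conn xy W_max W_y
  W_unique aut sigmaK sigma_x W_sigma.
(* The splitting is at least [c / g Q], so the half period is at most [pi / c * g Q]. *)
exists (pi / c); first by rewrite divr_gt0 // pi_gt0.
move=> T TC; apply/lee_addgt0Pr => eps eps0.
rewrite -leeBlDr //; apply: limf_einf_pinfty_ge.
(* An error [h = C / Q] in a coordinate costs its square at most [2 * h], hence [4 * h <= eps] for
   both coordinates. *)
apply: (@near_pinfty_ge _ (Num.max Q0 (4 * C / eps))) => Q.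
rewrite ge_max => /andP[QQ0 Qeps]; have Q_gt0 := lt_le_trans Q0_gt0 QQ0.
have [Ep [Em [/andP[lo _] amp]]] := H Q QQ0.
have gQ : 0 < Q ^+ (gdist e x y).-1 by rewrite exprn_gt0.
have dE : 0 < `|Ep - Em|.
  by rewrite -(pmulr_lgt0 _ gQ); exact: lt_le_trans lo.
pose t := pi / `|Ep - Em|.
have t0 : 0 <= t by rewrite divr_ge0 // pi_ge0.
have [X [Y [amp2XY Xc Ys]]] := amp t.
apply: (@le_trans _ _ (amp2 (hamiltonian e W Q) t x y)%:E); last first.
  apply: ereal_sup_ubound; exists t => //; apply: TC => //.
  rewrite /t /g ler_pdivrMr //.
  have -> : pi / c * Q ^+ (gdist e x y).-1 * `|Ep - Em| =
      pi * (`|Ep - Em| * Q ^+ (gdist e x y).-1) / c by ring.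
  by rewrite ler_pdivlMr // ler_pM2l // pi_gt0.
have [cE sE] : cos (t * Em) = - cos (t * Ep) /\ sin (t * Em) = - sin (t * Ep).
  have tE : t * `|Ep - Em| = pi by rewrite /t divfK // gt_eqF.
  have [sg|sg] := lerP 0 (Ep - Em).
    rewrite ger0_norm // in tE.
    have -> : t * Ep = t * Em + pi by rewrite -tE; ring.
    by rewrite cosDpi sinDpi !opprK.
  rewrite ltr0_norm // in tE.
  have -> : t * Em = t * Ep + pi by rewrite -tE; ring.
  by rewrite cosDpi sinDpi.
rewrite amp2XY -EFinB lee_fin; move: Xc Ys; rewrite cE sE.
set h := C / Q; have heps : 4 * h <= eps.
  rewrite /h mulrA ler_pdivrMr //; move: Qeps; rewrite ler_pdivrMr //; lra.
have := cos2Dsin2 (t * Ep); have := cos_le1 (t * Ep); have := cos_geN1 (t * Ep).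
have := sin_le1 (t * Ep); have := sin_geN1 (t * Ep).
move: (cos (t * Ep)) (sin (t * Ep)) => co si s1 s2 c1 c2 cs.
have -> : (co - - co) / 2 = co by lra.
have -> : (si - - si) / 2 = si by lra.
rewrite !ler_norml => /andP[X1 X2] /andP[Y1 Y2].
have sq (z o : R) : -1 <= o -> o <= 1 -> - h <= z - o -> z - o <= h ->
    o ^+ 2 - 2 * h <= z ^+ 2.
  by move=> ? ? ? ?; have := sqr_ge0 (z - o); nra.
have := sq X co c1 c2 X1 X2; have := sq Y si s1 s2 Y1 Y2; lra.
Qed.

(** Within such times the phases have hardly separated, so both coordinates of the amplitude stay
    below [1 / 2] in absolute value. *)
Lemma liminf_sup_littleo f : littleo_oo f g ->
  (liminf_sup e W x y (fun Q => [set t | (0 <= t <= f Q)%R]%classic) <= (1 / 2)%:E)%E.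
Proof.
have [c [C [Q0 [c0 C0 Q0_gt0 H]]]] := two_level_approximation simple conn xy W_max W_y
  W_unique aut sigmaK sigma_x W_sigma.
move=> fo; apply: limf_einf_pinfty_le.
have near1 : \forall Q \near pinfty_nbhs R, Num.max Q0 (4 * C) <= Q.
  exact: (@near_pinfty_ge _ (Num.max Q0 (4 * C))).
(* As [|Ep - Em| * g Q <= C], this choice of the small constant keeps the phase difference below
   [1 / 4]. *)
have near2 : \forall Q \near pinfty_nbhs R, `|f Q| <= (4 * C)^-1 * `|g Q|.
  by apply: fo; rewrite invr_gt0 mulr_gt0.
apply: filterS2 near1 near2 => Q; rewrite ge_max => /andP[QQ0 QC] fQ.
have Q_gt0 := lt_le_trans Q0_gt0 QQ0.
have [Ep [Em [/andP[_ hi] amp]]] := H Q QQ0.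
apply: ge_ereal_sup => _ [t /andP[t0 tf] <-]; rewrite lee_fin.
have [X [Y [-> Xc Ys]]] := amp t.
have gQ : 0 < Q ^+ (gdist e x y).-1 by rewrite exprn_gt0.
have tE : `|t * Ep - t * Em| <= 1 / 4.
  rewrite -mulrBr normrM (ger0_norm t0).
  have tle : t <= (4 * C)^-1 * g Q.
    apply: le_trans tf _; apply: le_trans (ler_norm _) _.
    by rewrite -[X in _ * X](ger0_norm (ltW gQ)).
  apply: le_trans (ler_wpM2r (normr_ge0 _) tle) _.
  rewrite -mulrA invfM -mulrA mul1r ler_piMr // mulrC ler_pdivrMr // mul1r.
  by rewrite mulrC.
have hQ : C / Q <= 1 / 4 by rewrite ler_pdivrMr //; lra.
have bound (z o1 o2 : R) : `|z - (o1 - o2) / 2| <= C / Q ->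
    `|o1 - o2| <= `|t * Ep - t * Em| -> z ^+ 2 <= 1 / 4.
  move=> h1 h2; have /andP[? ?] : - (1/2) <= z <= 1 / 2.
    have := le_trans h1 hQ; have := le_trans h2 tE; rewrite !ler_norml.
    by move=> /andP[? ?] /andP[? ?]; apply/andP; split; lra.
  nra.
have := bound _ _ _ Xc (cos_lipschitz _ _).
have := bound _ _ _ Ys (sin_lipschitz _ _); lra.
Qed.

Lemma perfect_tunneling :
  TC e W x y = 1%E /\ tunneling_time_of_order e W x y g.
Proof.
have [C C0 ge1] := liminf_sup_ge1.
have TC1 : TC e W x y = 1%E.
  apply/eqP; rewrite eq_le liminf_sup_le1 /=; apply: ge1 => Q t t0 _ //=.
split=> //; split.
  exists (fun Q => C * g Q); split.
    by exists C; apply: (@near_pinfty_ge _ 0) => Q _; rewrite normrM ger0_norm // ltW.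
  rewrite /tunnels_within TC1; apply/esym/eqP; rewrite eq_le liminf_sup_le1 /=.
  by apply: ge1 => Q t t0 tC /=; rewrite t0.
move=> f /liminf_sup_littleo; rewrite /tunnels_within TC1 => le12 eq1.
by rewrite -eq1 lee_fin in le12; lra.
Qed.
End Tunneling.

Theorem theorem5 (R : realType) (n : nat) (e : rel 'I_n) (W : 'I_n -> R)
    (x y : 'I_n) (sigma : 'I_n -> 'I_n) :
  simple_graph e -> connected_graph e -> x != y ->
  (forall v, W v <= W x) -> W y = W x ->
  (forall v, W v = W x -> v = x \/ v = y) ->
  graph_aut e sigma -> (forall v, sigma (sigma v) = v) ->
  sigma x = y -> (forall v, W (sigma v) = W v) ->
  TC e W x y = 1%E /\ TC e W y x = 1%E /\
  tunneling_time_of_order e W x y (fun Q => Q ^+ (gdist e x y).-1) /\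
  tunneling_time_of_order e W y x (fun Q => Q ^+ (gdist e x y).-1).
Proof.
move=> sg conn xy Wmax Wy Wu aut sK sx Ws.
have sy : sigma y = x by rewrite -sx sK.
have [TCxy ordxy] := perfect_tunneling sg conn xy Wmax Wy Wu aut sK sx Ws.
(* The hypotheses are symmetric in the two wells, with the same involution. *)
have [||||TCyx ordyx] := perfect_tunneling (x := y) (y := x) sg conn _ _ _ _ aut sK sy Ws.
- by rewrite eq_sym.
- by move=> v; rewrite Wy.
- by rewrite Wy.
- by move=> v; rewrite Wy => /Wu [] ->; [right|left].
(* [sigma] exchanges [x] and [y] and does not increase distances, so the two orders agree. *)
suff dxy : gdist e y x = gdist e x y by rewrite dxy in ordyx.
have := gdist_aut conn x y aut; have := gdist_aut conn y x aut.
by rewrite sx sy => le1 le2; apply/eqP; rewrite eqn_leq le2 le1.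
Qed.
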